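(* Three-dimensional canonical fusion bialgebras whose basis $\{x_1=1,x_2,x_3\}$ satisfies $x_2^*=x_2$ are classified by three parameters $d_2,d_3,a$ such that, with $b=1-a$, $$d_2,d_3\ge1,\qquad 0\le a\le1,\qquad d_2^2-1-a d_3^2\ge0,\qquad d_3^2-1-b d_2^2\ge0,$$ and the multiplication is $$x_2x_2=x_1+\frac{d_2^2-1-a d_3^2}{d_2}x_2+a d_3 x_3,\qquad x_2x_3=a d_3x_2+b d_2x_3,\qquad x_3x_3=x_1+b d_2x_2+\frac{d_3^2-1-b d_2^2}{d_3}x_3.$$ That is: (i) for every such canonical fusion bialgebra, with $d_2=d(x_2)$ and $d_3=d(x_3)$, there is a unique $a$ such that, with $b=1-a$, the inequalities $d_2,d_3\ge1$, $0\le a\le1$, $d_2^2-1-a d_3^2\ge0$, $d_3^2-1-b d_2^2\ge0$ and the multiplication rules $x_2x_2=x_1+\frac{d_2^2-1-a d_3^2}{d_2}x_2+a d_3 x_3$, $x_2x_3=a d_3x_2+b d_2x_3$, $x_3x_3=x_1+b d_2x_2+\frac{d_3^2-1-b d_2^2}{d_3}x_3$ hold; (ii) conversely, for any $d_2,d_3,a$ satisfying, with $b=1-a$, the inequalities $d_2,d_3\ge1$, $0\le a\le1$, $d_2^2-1-a d_3^2\ge0$, $d_3^2-1-b d_2^2\ge0$, the rules $x_2x_2=x_1+\frac{d_2^2-1-a d_3^2}{d_2}x_2+a d_3 x_3$, $x_2x_3=x_3x_2=a d_3x_2+b d_2x_3$, $x_3x_3=x_1+b d_2x_2+\frac{d_3^2-1-b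 d_2^2}{d_3}x_3$ (with $x_1=1$ and $x_j^*=x_j$) define a three-dimensional algebra with $\mathbb{R}_{\ge0}$-basis $\{x_1=1,x_2,x_3\}$ with $d(x_2)=d_2$, $d(x_3)=d_3$, hence a canonical fusion bialgebra of this kind.
   Context: $\mathbb{R}_{\ge0}$-basis: a unital $*$-algebra $\mathcal{B}$ over $\mathbb{C}$ has an $\mathbb{R}_{\ge 0}$-basis $B=\{x_1=1_{\mathcal{B}},x_2,\dots,x_m\}$ if (1) it is a linear basis over $\mathbb{C}$; (2) $x_jx_k=\sum_s N_{j,k}^s x_s$ with $N_{j,k}^s\in\mathbb{R}_{\ge0}$; (3) there is an involution $*$ on $\{1,\dots,m\}$ such that $x_k^*=x_{k^*}$ and $N_{j,k}^1=\delta_{j,k^*}$. Put $\tau(x_j)=\delta_{j,1}$; this is a faithful tracial state, for which $B$ is orthonormal in $L^2(\mathcal{B},\tau)$, and $\mathcal{B}$ becomes a $C^*$-algebra via left multiplication on $L^2(\mathcal{B},\tau)$; $d:\mathcal{B}\to\mathbb{C}$ is the linear functional with $d(x_j)$ equal to the operator norm of left multiplication by $x_j$. The canonical fusion bialgebra of $(\mathcal{B},B)$ is $(\mathcal{A},\mathcal{B},\mathfrak{F},d,\tau)$, where $\mathcal{A}$ is the commutative $C^*$-algebra with linear basis $B$, multiplication $x_j\diamond x_k=\delta_{j,k}d(x_j)^{-1}x_j$ and anti-linear involution $x_j^{\#}=x_j$, $d$ is regarded as a functional on $\mathcal{A}$, and $\mathfrak{F}(x_j)=x_j$. Every canonical fusion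 bialgebra arises in this way from a unique $\mathbb{R}_{\ge0}$-basis (its basis); its dimension is $\dim_{\mathbb{C}}\mathcal{B}$. *)

(* Defs.v *)
From mathcomp Require Import all_boot all_order all_algebra all_field.
From mathcomp Require Import complex.
From mathcomp Require Import boolp classical_sets reals.

Set Implicit Arguments.
Unset Strict Implicit.
Unset Printing Implicit Defensive.

Import GRing.Theory Num.Theory.
Local Open Scope ring_scope.
Local Open Scope complex_scope.
Local Open Scope classical_set_scope.

(* Only finite-dimensional algebras occur, hence the carrier in falgType.
   The conjunction says that star is an antilinear, antimultiplicative
   involution. *)
Record starAlgebra (R : realType) := StarAlgebra {
  star_carrier :> falgType R[i];
  star : star_carrier -> star_carrier;
  star_axioms :
    [/\ forall u v, star (u + v) = star u + star v,
        forall (c : R[i]) u, star (c *: u) = conjc c *: star u,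
        forall u v, star (u * v) = star v * star u
      & involutive star]
}.

(* Indices start at 0: the basis {x_1 = 1, ..., x_m} is x`_0, ..., x`_n with
   m = n + 1, so that N j k ord0 is the coefficient N_{j,k}^1 of the unit. *)
Definition nonneg_basis (R : realType) (B : starAlgebra R) (n : nat)
    (x : n.+1.-tuple B) : Prop :=
  [/\ basis_of fullv x,
      x`_0 = 1
    & exists (N : 'I_n.+1 -> 'I_n.+1 -> 'I_n.+1 -> R)
             (dual : 'I_n.+1 -> 'I_n.+1),
      [/\ forall j k s, 0 <= N j k s,
          forall j k : 'I_n.+1, x`_j * x`_k = \sum_s (N j k s)%:C *: x`_s,
          involutive dual,
          forall k : 'I_n.+1, star x`_k = x`_(dual k)
        & forall j k, N j k ord0 = (j == dual k)%:R]].

(* The norm of L^2(B, tau), for the inner product <u, v> = tau(v^* u). *)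
Definition L2norm (R : realType) (B : starAlgebra R) (tau : B -> R[i])
    (v : B) : R :=
  Num.sqrt (complex.Re (tau (star v * v))).

Definition left_mul_norm (R : realType) (B : starAlgebra R) (tau : B -> R[i])
    (u : B) : R :=
  sup [set L2norm tau (u * v) | v in [set v | L2norm tau v <= 1]].

(* The quintuple (A, B, F, d, tau), with d regarded as a functional on A;
   [star] of fusA is the involution written #. *)
Record fusionData (R : realType) := FusionData {
  fusA : starAlgebra R;
  fusB : starAlgebra R;
  fourier : 'Hom(fusA, fusB);
  dimA : {scalar fusA};
  tau : {scalar fusB}
}.

(* d as a functional on B, transported by the inverse Fourier transform. *)
Definition dimB (R : realType) (F : fusionData R) (u : fusB F) : R[i] :=
  dimA F ((fourier F)^-1%VF u).

(* F is the canonical fusion bialgebra of (fusB F, x). The tuple y is the copy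
   in A of the basis x of B, so that F(x_j) = x_j reads fourier y_j = x_j. *)
Definition canonical_fusion_bialgebra (R : realType) (F : fusionData R)
    (n : nat) (x : n.+1.-tuple (fusB F)) : Prop :=
  [/\ nonneg_basis x,
      forall j : 'I_n.+1, tau F x`_j = (j == ord0)%:R
    & exists y : n.+1.-tuple (fusA F),
      [/\ basis_of fullv y,
          forall j k : 'I_n.+1,
            y`_j * y`_k = (j == k)%:R *: ((dimA F y`_j)^-1 *: y`_j),
          forall j : 'I_n.+1, star y`_j = y`_j,
          forall j : 'I_n.+1, dimA F y`_j = (left_mul_norm (tau F) x`_j)%:C
        & forall j : 'I_n.+1, fourier F y`_j = x`_j]].

Definition rank3_parameters (R : realType) (d2 d3 a : R) : Prop :=
  let b := 1 - a in
  [/\ 1 <= d2, 1 <= d3, 0 <= a <= 1,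
      0 <= d2 ^+ 2 - 1 - a * d3 ^+ 2
    & 0 <= d3 ^+ 2 - 1 - b * d2 ^+ 2].

Definition rank3_multiplication (R : realType) (B : starAlgebra R)
    (x1 x2 x3 : B) (d2 d3 a : R) : Prop :=
  let b := 1 - a in
  [/\ x2 * x2 = x1 + ((d2 ^+ 2 - 1 - a * d3 ^+ 2) / d2)%:C *: x2
                   + (a * d3)%:C *: x3,
      x2 * x3 = (a * d3)%:C *: x2 + (b * d2)%:C *: x3
    & x3 * x3 = x1 + (b * d2)%:C *: x2
                   + ((d3 ^+ 2 - 1 - b * d2 ^+ 2) / d3)%:C *: x3].

(* Main.v *)
(* In a rank-3 basis with x_2 self-dual, x_3 is self-dual too, so the structure
   constants are fully symmetric: x_2^2 = 1 + p x_2 + q x_3,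
   x_2 x_3 = q x_2 + s x_3, x_3^2 = 1 + s x_2 + u x_3, and associativity reduces
   to 1 + p s + q u = q^2 + s^2. Such an algebra has a positive character e, and
   e(x_j) is the norm of left multiplication by x_j: the vector (e(x_k))_k is a
   common eigenvector and Schur's test gives the upper bound. Hence d = e is
   multiplicative, and d_2 d_3 = q d_2 + s d_3 says that a = q / d_3 and
   b = s / d_2 add up to 1. Conversely, the given parameters satisfy the
   associativity equation, and (1, d_2, d_3) is a positive character. *)
Require Import Defs.
From HB Require Import structures.
From mathcomp Require Import all_boot all_order all_algebra all_field.
From mathcomp Require Import complex.
From mathcomp Require Import boolp classical_sets reals.
From mathcomp Require Import ring lra.

Set Implicit Arguments.
Unset Strict Implicit.
Unset Printing Implicit Defensive.

Import Order.TTheory GRing.Theory Num.Theory.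
Local Open Scope ring_scope.
Local Open Scope complex_scope.

(** * Schur's test for nonnegative matrices *)

(** Cauchy-Schwarz as nonnegativity of a variance: with weights [c k * w k], the squared deviations
    of [v k / w k] from its mean [A / W] add up to [(W * Q - A ^+ 2) / W]. *)
Lemma sqr_sum_le_weighted (F : realFieldType) (I : finType) (c w v : I -> F) :
  (forall k, 0 <= c k) -> (forall k, 0 < w k) -> 0 < \sum_k c k * w k ->
  (\sum_k c k * v k) ^+ 2
    <= (\sum_k c k * w k) * \sum_k c k * (v k ^+ 2 / w k).
Proof.
move=> c0 w0; set W := \sum_k c k * w k; set A := \sum_k c k * v k.
set Q := \sum_k _ => W0.
have : 0 <= \sum_k c k * w k * (v k / w k - A / W) ^+ 2.
  apply: sumr_ge0 => k _; rewrite mulr_ge0 ?sqr_ge0 // mulr_ge0 //.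
  exact: ltW.
have -> : \sum_k c k * w k * (v k / w k - A / W) ^+ 2
    = Q - 2 * (A / W) * A + (A / W) ^+ 2 * W.
  rewrite /Q /A /W -/W -/A !mulr_sumr -sumrB -big_split /=.
  by apply: eq_bigr => k _; field; rewrite !gt_eqF.
have -> : Q - 2 * (A / W) * A + (A / W) ^+ 2 * W = (W * Q - A ^+ 2) / W.
  by field; rewrite gt_eqF.
by rewrite pmulr_lge0 ?invr_gt0 // subr_ge0.
Qed.

(** Weighted Cauchy-Schwarz bounds each row, the row equation supplying one factor [l]. After
    exchanging the sums, the column equation supplies the other and cancels the denominator
    [w k]. *)
Lemma schur_test (F : realFieldType) (I : finType) (M : I -> I -> F)
    (w : I -> F) (l : F) (v : I -> F) :
  (forall i k, 0 <= M i k) -> (forall k, 0 < w k) -> 0 < l ->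
  (forall i, \sum_k M i k * w k = l * w i) ->
  (forall k, \sum_i M i k * w i = l * w k) ->
  \sum_i (\sum_k M i k * v k) ^+ 2 <= l ^+ 2 * \sum_k v k ^+ 2.
Proof.
move=> M0 w0 l0 Mw MTw.
apply: (@le_trans _ _ (\sum_i l * w i * \sum_k M i k * (v k ^+ 2 / w k))).
  apply: ler_sum => i _; rewrite -Mw; apply: sqr_sum_le_weighted => //.
  by rewrite Mw mulr_gt0.
under eq_bigr do rewrite mulr_sumr.
rewrite exchange_big mulr_sumr; apply: ler_sum => k _ /=.
rewrite (eq_bigr (fun i => l * (v k ^+ 2 / w k) * (M i k * w i))) => [|i _].
  rewrite -mulr_sumr MTw le_eqVlt; apply/orP; left; apply/eqP.
  by field; rewrite gt_eqF.
by ring.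
Qed.

(** * A positive character in rank three *)

(* When q, s > 0, eliminating e3 from the first two equations leaves a cubic
   in e2 that is negative at s, and its root beyond s gives e3 > 0. *)
Lemma rank3_character (F : rcfType) (p q s u : F) :
  0 <= q -> 0 <= s -> 1 + p * s + q * u = q ^+ 2 + s ^+ 2 ->
  exists e2 e3 : F,
    [/\ 0 < e2, 0 < e3, e2 * e2 = 1 + p * e2 + q * e3,
        e2 * e3 = q * e2 + s * e3 & e3 * e3 = 1 + s * e2 + u * e3].
Proof.
have quadratic_root c t : 0 < c -> exists2 y : F, 0 < y & y * y = c + t * y.
  move=> c0; have D : t < Num.sqrt (t ^+ 2 + 4 * c).
    apply: (le_lt_trans (ler_norm t)); rewrite -sqrtr_sqr ltr_sqrt; last first.
      by have := sqr_ge0 t; lra.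
    by lra.
  exists ((t + Num.sqrt (t ^+ 2 + 4 * c)) / 2).
    have := ler_norm (- t); rewrite normrN.
    have : `|t| < Num.sqrt (t ^+ 2 + 4 * c).
      rewrite -sqrtr_sqr ltr_sqrt; last by have := sqr_ge0 t; lra.
      by lra.
    by lra.
  have : Num.sqrt (t ^+ 2 + 4 * c) ^+ 2 = t ^+ 2 + 4 * c.
    by rewrite sqr_sqrtr //; have := sqr_ge0 t; lra.
  set r := Num.sqrt _ => r2.
  have -> : c = (r ^+ 2 - t ^+ 2) / 4 by rewrite r2; field.
  by field.
(* If [q = 0], associativity reads [1 + p * s = s ^+ 2]: hence [s] is nonzero and [e2 = s] solves
   the first equation. The second then holds for any [e3], and the third is a quadratic in [e3]. The
   case [s = 0] is symmetric, with [e3 = q]. *)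
rewrite le_eqVlt => /orP[/eqP<- | q0] s_ge0 assoc.
  have s0 : 0 < s.
    rewrite lt_def s_ge0 andbT; apply/eqP => s0.
    by move: assoc; rewrite s0; lra.
  have c0 : 0 < 1 + s * s by have := mulr_gt0 s0 s0; lra.
  have [y y0 y2] := quadratic_root _ u c0.
  by exists s, y; split=> //; lra.
move: s_ge0; rewrite le_eqVlt => /orP[/eqP s0 | s0].
  have c0 : 0 < 1 + q * q by have := mulr_gt0 q0 q0; lra.
  have [y y0 y2] := quadratic_root _ p c0.
  by exists y, q; split=> //; rewrite -?s0 in assoc *; lra.
(* The first equation gives [q * e3 = e2 ^+ 2 - 1 - p * e2]; inserting this in [q] times
   [e3 * (e2 - s) = q * e2] gives [f.[e2] = 0]. *)
pose f : {poly F} := ('X ^+ 2 - 1 - p *: 'X) * ('X - s%:P) - q ^+ 2 *: 'X.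
have fE x : f.[x] = (x ^+ 2 - 1 - p * x) * (x - s) - q ^+ 2 * x.
  by rewrite !hornerE.
have [m sm fm] : exists2 m, s <= m & 0 <= f.[m].
  have pq : 0 <= `|p| + q ^+ 2 by rewrite addr_ge0 ?sqr_ge0.
  (* This [m] is large enough for [1 <= m - s] and [q ^+ 2 * m <= m ^+ 2 - 1 - p * m], which
     together give [0 <= f.[m]]. *)
  exists (s + 2 + `|p| + q ^+ 2); first by rewrite !ler_wpDr ?sqr_ge0 //; lra.
  rewrite fE; have := ler_norm p; have := sqr_ge0 q; have := normr_ge0 p.
  move: `|p| (q ^+ 2) => P Q P0 Q0 pP; set m := s + 2 + P + Q.
  have m0 : 0 < m by rewrite /m; lra.
  have pm : p * m <= P * m by rewrite ler_pM2r.
  have sm : 0 <= s * m by rewrite mulr_ge0 // ltW.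
  have Qm : 0 <= Q * m by rewrite mulr_ge0 // ltW.
  have mm : m ^+ 2 = (s + 2 + P + Q) * m by rewrite expr2.
  have m2 : 2 <= m by rewrite /m; lra.
  have mQ : Q * m <= m ^+ 2 - 1 - p * m by lra.
  have : (Q * m) * (m - s) <= (m ^+ 2 - 1 - p * m) * (m - s).
    by rewrite ler_pM2r // /m; lra.
  have : Q * m <= Q * m * (m - s) by rewrite ler_peMr // /m; lra.
  by lra.
have fs : f.[s] <= 0.
  by rewrite fE subrr mulr0 sub0r oppr_le0 mulr_ge0 ?sqr_ge0 // ltW.
have [|x] := @poly_ivt _ f s m sm; first by rewrite fs fm.
move=> /andP[sx xm] /rootP; rewrite fE => fx.
(* The root is not [s] itself, since [f.[s] = - (q ^+ 2 * s)] is nonzero; so the quotient defining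
   [y] makes sense and is positive. *)
have sx' : 0 < x - s.
  rewrite subr_gt0 lt_def sx andbT; apply/eqP => xs.
  have : 0 < q ^+ 2 * s by rewrite mulr_gt0 ?exprn_gt0.
  by move: fx; rewrite xs; lra.
have x0 : 0 < x by lra.
have xsN : x - s != 0 by rewrite gt_eqF.
set y := q * x / (x - s).
have yx : y * (x - s) = q * x by rewrite /y divfK.
have qy : q * y = x ^+ 2 - 1 - p * x.
  apply: (mulIf xsN); rewrite -mulrA yx -[RHS]subr0 -fx; ring.
exists x, y; split=> //; first by rewrite divr_gt0 // mulr_gt0.
- by rewrite qy; ring.
- by rewrite -[q * x]yx; ring.
(* For the third equation, multiply by [x - s] and replace [u * q] through associativity: the two
   sides then differ by [f.[x]]. *)
apply: (mulIf xsN); rewrite -mulrA yx.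
have -> : y * (q * x) = (x ^+ 2 - 1 - p * x) * x by rewrite -qy; ring.
rewrite [RHS]mulrDl -[u * y * _]mulrA yx.
have -> : u * (q * x) = (q ^+ 2 + s ^+ 2 - 1 - p * s) * x by rewrite -assoc; ring.
rewrite -[LHS]subr0 -fx; ring.
Qed.

(** * Frobenius reciprocity, the L^2 norm and the norm of left multiplication *)

Lemma star_sum (R : realType) (B : starAlgebra R) (I : finType)
    (c : I -> R[i]) (v : I -> B) :
  star (\sum_k c k *: v k) = \sum_k conjc (c k) *: star (v k).
Proof.
have [starD starZ _ _] := star_axioms B.
have star0 : star (0 : B) = 0.
  by apply: (@addrI _ (star 0)); rewrite -starD !addr0.
by rewrite (big_morph _ starD star0); apply: eq_bigr => k _; apply: starZ.
Qed.

(** The body of the existential in [nonneg_basis], named so that lemmas can speak about fixed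
    witnesses [N] and [dual]. *)
Definition fusion_rules (R : realType) (B : starAlgebra R) (n : nat)
    (x : n.+1.-tuple B) (N : 'I_n.+1 -> 'I_n.+1 -> 'I_n.+1 -> R)
    (dual : 'I_n.+1 -> 'I_n.+1) : Prop :=
  [/\ forall j k s, 0 <= N j k s,
      forall j k : 'I_n.+1, x`_j * x`_k = \sum_s (N j k s)%:C *: x`_s,
      involutive dual,
      forall k : 'I_n.+1, star x`_k = x`_(dual k)
    & forall j k, N j k ord0 = (j == dual k)%:R].

Lemma scalar_sum (K : nzRingType) (V : lmodType K) (I : finType)
    (f : {scalar V}) (c : I -> K) (v : I -> V) :
  f (\sum_k c k *: v k) = \sum_k c k * f (v k).
Proof. by rewrite linear_sum; apply: eq_bigr => k _; rewrite linearZ. Qed.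

Lemma sum_delta (K : nzRingType) (I : finType) (f : I -> K) (j : I) :
  \sum_k f k * (k == j)%:R = f j.
Proof.
rewrite (bigD1 j) //= eqxx mulr1 big1 ?addr0 // => k /negPf->.
by rewrite mulr0.
Qed.

Section FusionRules.
Context (R : realType) (B : starAlgebra R) (n : nat) (x : n.+1.-tuple B).
Context (N : 'I_n.+1 -> 'I_n.+1 -> 'I_n.+1 -> R) (dual : 'I_n.+1 -> 'I_n.+1).
Context (tau : {scalar B}).
Context (rules : fusion_rules x N dual).
Context (tauE : forall j : 'I_n.+1, tau x`_j = (j == ord0)%:R).

Lemma tau_mul (j k : 'I_n.+1) : tau (x`_j * x`_k) = (j == dual k)%:R.
Proof.
have [_ -> _ _ N0] := rules; rewrite scalar_sum.
under eq_bigr do rewrite tauE.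
by rewrite sum_delta N0; case: eqP.
Qed.

(** Frobenius reciprocity: left multiplication by the adjoint of x_j is the adjoint operator. Both
    coefficients are the value of [tau] at x_s^* x_j x_k, bracketed in two ways. *)
Lemma fusion_coef_dual j k s : N j k s = N (dual j) s k.
Proof.
have [_ xM dualK starx _] := rules.
have [_ _ starM starK] := star_axioms B.
apply: (@complexI R).
transitivity (tau (x`_(dual s) * (x`_j * x`_k))).
  rewrite xM mulr_sumr; under eq_bigr do rewrite -scalerAr.
  rewrite scalar_sum.
  under eq_bigr do rewrite tau_mul (inj_eq (can_inj dualK)) eq_sym.
  by rewrite sum_delta.
have -> : x`_(dual s) * (x`_j * x`_k) = star (x`_(dual j) * x`_s) * x`_k.
  by rewrite starM !starx dualK mulrA.
rewrite xM star_sum mulr_suml; under eq_bigr do rewrite -scalerAl starx.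
rewrite scalar_sum; under eq_bigr do rewrite tau_mul (inj_eq (can_inj dualK)).
by rewrite sum_delta /= oppr0.
Qed.

(** The basis is orthonormal. Real and imaginary parts are kept apart because Schur's test is about
    real vectors and is applied to each of them. *)
Lemma L2normE (c : 'I_n.+1 -> R[i]) :
  L2norm tau (\sum_k c k *: x`_k)
    = Num.sqrt (\sum_k complex.Re (c k) ^+ 2 + \sum_k complex.Im (c k) ^+ 2).
Proof.
have [_ _ dualK starx _] := rules.
rewrite /L2norm star_sum; congr Num.sqrt.
rewrite mulr_suml linear_sum /=.
have -> : \sum_i tau (conjc (c i) *: star x`_i * \sum_k c k *: x`_k)
   = (\sum_k (complex.Re (c k) ^+ 2 + complex.Im (c k) ^+ 2))%:C.
  rewrite rmorph_sum /=; apply: eq_bigr => i _.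
  rewrite starx -scalerAl mulr_sumr linearZ /=.
  under eq_bigr do rewrite -scalerAr.
  rewrite scalar_sum.
  under eq_bigr do rewrite tau_mul (inj_eq (can_inj dualK)) eq_sym.
  by rewrite sum_delta add_Re2_Im2 mulrC -sqr_normc.
by rewrite /= big_split.
Qed.

Lemma left_mul_coord (j : 'I_n.+1) (c : 'I_n.+1 -> R[i]) :
  x`_j * (\sum_k c k *: x`_k)
    = \sum_s (\sum_k (N j k s)%:C * c k) *: x`_s.
Proof.
have [_ xM _ _ _] := rules.
rewrite mulr_sumr; under eq_bigr do rewrite -scalerAr xM scaler_sumr.
rewrite exchange_big; apply: eq_bigr => s _ /=.
by rewrite scaler_suml; apply: eq_bigr => k _; rewrite scalerA mulrC.
Qed.

(* A positive character e satisfies L_j e = e_j e, so e is the Perron-Frobenius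
   eigenvector of all the left multiplications, which Schur's test applies to. *)
Lemma left_mul_norm_character (e : 'I_n.+1 -> R) :
  basis_of fullv x ->
  (forall j, 0 < e j) -> (forall j, e (dual j) = e j) ->
  (forall j k, e j * e k = \sum_s N j k s * e s) ->
  forall j : 'I_n.+1, left_mul_norm tau x`_j = e j.
Proof.
move=> x_basis e0 e_dual e_char j; have [N0 _ _ _ _] := rules.
have Re_sum s (c : 'I_n.+1 -> R[i]) : complex.Re (\sum_k (N j k s)%:C * c k)
    = \sum_k N j k s * complex.Re (c k).
  rewrite (big_morph (@complex.Re R) (id1 := 0) (op1 := +%R)) // => [|[? ?] [] //].
  by apply: eq_bigr => k _; case: (c k) => ? ? /=; rewrite mul0r subr0.
have Im_sum s (c : 'I_n.+1 -> R[i]) : complex.Im (\sum_k (N j k s)%:C * c k)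
    = \sum_k N j k s * complex.Im (c k).
  rewrite (big_morph (@complex.Im R) (id1 := 0) (op1 := +%R)) // => [|[? ?] [] //].
  by apply: eq_bigr => k _; case: (c k) => ? ? /=; rewrite mul0r addr0.
have schur (v : 'I_n.+1 -> R) :
    \sum_s (\sum_k N j k s * v k) ^+ 2 <= e j ^+ 2 * \sum_k v k ^+ 2.
  (* The column equation is [e_char]; the row equation follows from it by Frobenius reciprocity and
     [e_dual]. *)
  apply: (@schur_test _ _ (fun s k => N j k s) e) => // s.
  by under eq_bigr do rewrite fusion_coef_dual; rewrite -e_char e_dual.
have bounded : ubound [set L2norm tau (x`_j * v)
    | v in [set v | L2norm tau v <= 1]]%classic (e j).
  move=> _ [v /= + <-]; rewrite (coord_basis x_basis (memvf v)).
  rewrite left_mul_coord !L2normE => v1.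
  have := ler_wpM2l (ltW (e0 j)) v1; rewrite mulr1; apply: le_trans.
  rewrite -[e j]gtr0_norm // -sqrtr_sqr -sqrtrM ?sqr_ge0 //.
  apply: ler_wsqrtr.
  rewrite mulrDr; apply: lerD; apply: le_trans (schur _).
    by under eq_bigr do rewrite Re_sum.
  by under eq_bigr do rewrite Im_sum.
(* The upper bound is attained at the vector [e] divided by its length [r]. *)
set r := Num.sqrt (\sum_k e k ^+ 2).
have r0 : 0 < r.
  rewrite sqrtr_gt0 (bigD1 ord0) //= ltr_wpDr ?exprn_gt0 ?sumr_ge0 // => k _.
  exact: sqr_ge0.
have L2norm_real (c : R) : 0 <= c ->
    L2norm tau (\sum_k (c * e k)%:C *: x`_k) = c * r.
  move=> c0; rewrite L2normE /= [X in _ + X]big1 ?addr0 => [|k _]; last first.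
    by rewrite expr0n.
  under eq_bigr do rewrite exprMn.
  by rewrite -mulr_sumr sqrtrM ?sqr_ge0 // sqrtr_sqr ger0_norm.
pose v : B := \sum_k (r^-1 * e k)%:C *: x`_k.
have v1 : L2norm tau v = 1 by rewrite L2norm_real ?mulVf ?gt_eqF // invr_ge0 ltW.
have xv : L2norm tau (x`_j * v) = e j.
  rewrite left_mul_coord.
  have -> : \sum_s (\sum_k (N j k s)%:C * (r^-1 * e k)%:C) *: x`_s
      = \sum_s ((e j * r^-1) * e s)%:C *: x`_s.
    apply: eq_bigr => s _; congr (_ *: _); rewrite -mulrA mulrCA -e_dual e_char.
    rewrite mulr_sumr rmorph_sum; apply: eq_bigr => k _ /=.
    by rewrite -fusion_coef_dual -rmorphM /= mulrCA.
  rewrite L2norm_real; first by rewrite divfK // gt_eqF.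
  by rewrite divr_ge0 // ltW.
apply/le_anti/andP; split.
  by apply: ge_sup => //; exists (e j), v => //=; rewrite v1.
by apply: ub_le_sup; [exists (e j) | exists v => //=; rewrite v1].
Qed.

End FusionRules.

(** * Identities between structure constants, by comparing coordinates *)

Lemma free_sum_inj (K : fieldType) (V : vectType K) (n : nat)
    (x : n.-tuple V) (a b : 'I_n -> K) :
  free x -> \sum_k a k *: x`_k = \sum_k b k *: x`_k -> a =1 b.
Proof.
by move=> fx E k; rewrite -(coord_sum_free a k fx) E coord_sum_free.
Qed.

Section FusionBasis.
Context (R : realType) (B : starAlgebra R) (n : nat) (x : n.+1.-tuple B).
Context (N : 'I_n.+1 -> 'I_n.+1 -> 'I_n.+1 -> R) (dual : 'I_n.+1 -> 'I_n.+1).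
Context (rules : fusion_rules x N dual) (x_free : free x) (x1 : x`_0 = 1).

Lemma fusion_nth_inj (j k : 'I_n.+1) : x`_j = x`_k -> j = k.
Proof.
move/eqP; rewrite nth_uniq ?size_tuple ?free_uniq ?ltn_ord //.
by move/eqP/val_inj.
Qed.

Lemma fusion_dual_fixed (k : 'I_n.+1) : star x`_k = x`_k -> dual k = k.
Proof. by have [_ _ _ -> _] := rules; apply: fusion_nth_inj. Qed.

Lemma fusion_dual0 : dual ord0 = ord0.
Proof.
apply: fusion_dual_fixed; rewrite x1; have [_ _ starM starK] := star_axioms B.
by have := starM (star 1) 1; rewrite starK !mulr1 starK => {2}->.
Qed.

Lemma fusion_coef1l k s : N ord0 k s = (k == s)%:R.
Proof.
have [_ xM _ _ _] := rules; apply: (@complexI R).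
have /free_sum_inj : \sum_s (N ord0 k s)%:C *: x`_s
    = \sum_s ((k == s)%:R : R[i]) *: x`_s.
  rewrite -xM x1 mul1r (bigD1 k) //= eqxx scale1r big1 ?addr0 // => i.
  by rewrite eq_sym => /negPf->; rewrite scale0r.
by move=> /(_ x_free s) ->; case: eqP.
Qed.

(** Apply [star], which reverses products, to the expansion of x_j x_k. *)
Lemma fusion_coef_rev j k s : N j k s = N (dual k) (dual j) (dual s).
Proof.
have [_ xM dualK starx _] := rules; have [_ _ starM _] := star_axioms B.
apply: (@complexI R).
have /free_sum_inj : \sum_s (N j k (dual s))%:C *: x`_s
    = \sum_s (N (dual k) (dual j) s)%:C *: x`_s.
  rewrite -xM -!starx -starM xM star_sum [RHS](reindex_inj (can_inj dualK)) /=.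
  by apply: eq_bigr => i _; rewrite oppr0 starx dualK.
by move=> /(_ x_free (dual s)); rewrite dualK.
Qed.

Lemma fusion_coef_assoc j k m s :
  \sum_l N j k l * N l m s = \sum_l N k m l * N j l s.
Proof.
have [_ xM _ _ _] := rules; apply: (@complexI R).
have /free_sum_inj : \sum_s (\sum_l N j k l * N l m s)%:C *: x`_s
    = \sum_s (\sum_l N k m l * N j l s)%:C *: x`_s.
  transitivity (x`_j * x`_k * x`_m).
    rewrite xM mulr_suml; under [RHS]eq_bigr do rewrite -scalerAl xM scaler_sumr.
    rewrite exchange_big; apply: eq_bigr => i _ /=.
    rewrite rmorph_sum scaler_suml; apply: eq_bigr => l _ /=.
    by rewrite scalerA rmorphM.
  rewrite -mulrA xM mulr_sumr.
  under eq_bigr do rewrite -scalerAr xM scaler_sumr.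
  rewrite exchange_big; apply: eq_bigr => i _ /=.
  rewrite rmorph_sum scaler_suml; apply: eq_bigr => l _ /=.
  by rewrite scalerA rmorphM.
by move=> /(_ x_free s).
Qed.

End FusionBasis.

(** * The functional d on the basis of B *)

(** The inverse used in [dimB] is in general only a pseudo-inverse. It undoes [fourier] here because
    [fourier] maps a basis of A to a free family, so its kernel is trivial. *)
Lemma dimB_basis (R : realType) (F : fusionData R) (n : nat)
    (x : n.+1.-tuple (fusB F)) :
  canonical_fusion_bialgebra x ->
  forall j : 'I_n.+1, dimB x`_j = (left_mul_norm (tau F) x`_j)%:C.
Proof.
move=> [[x_basis _ _] _ [y [y_basis _ _ dimy Fy]]] j.
have fourierK : lker (fourier F) == 0%VS.
  rewrite -subv0; apply/subvP => v; rewrite memv_ker memv0.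
  rewrite (coord_basis y_basis (memvf v)) linear_sum.
  under eq_bigr do rewrite linearZ /= Fy.
  move/eqP/(freeP (basis_free x_basis)) => v0.
  by rewrite big1 => // k _; rewrite v0 scale0r.
by rewrite /dimB -{1}Fy lker0_lfunK // dimy.
Qed.

(** * Rank three: from the bialgebra to the parameters *)

Notation ord3_1 := (@Ordinal 3 1 isT).
Notation ord3_2 := (@Ordinal 3 2 isT).

Lemma big_ord3 (V : nmodType) (f : 'I_3 -> V) :
  \sum_i f i = f ord0 + f ord3_1 + f ord3_2.
Proof.
rewrite !big_ord_recl big_ord0 addr0 addrA.
by congr (_ + f _ + f _); apply: val_inj.
Qed.

Lemma ord3_ind (P : 'I_3 -> Prop) :
  P ord0 -> P ord3_1 -> P ord3_2 -> forall i, P i.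
Proof.
by move=> P0 P1 P2 [[|[|[|//]]] lt3]; [move: P0 | move: P1 | move: P2];
  congr P; apply: val_inj.
Qed.

Lemma rank3_classification (R : realType) (F : fusionData R)
    (x : 3.-tuple (fusB F)) (d2 d3 : R) :
  canonical_fusion_bialgebra x -> star x`_1 = x`_1 ->
  dimB x`_1 = d2%:C -> dimB x`_2 = d3%:C ->
  exists! a : R,
    rank3_parameters d2 d3 a /\ rank3_multiplication x`_0 x`_1 x`_2 d2 d3 a.
Proof.
move=> canon star_x1 dim_x1 dim_x2.
have [[x_basis x0E [N [dual rules]]] tauE _] := canon.
have x_free := basis_free x_basis; have [N0 xM dualK _ Nunit] := rules.
have dual0 : dual ord0 = ord0 := fusion_dual0 rules x_free x0E.
have dual1 : dual ord3_1 = ord3_1 by apply: (fusion_dual_fixed rules).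
(* An involution of three indices that fixes two of them fixes the third. *)
have dual2 : dual ord3_2 = ord3_2.
  have := dualK ord3_2; elim/ord3_ind: (dual ord3_2) => //.
    by rewrite dual0.
  by rewrite dual1.
have dualE : dual =1 id by apply: ord3_ind.
have N1l := fusion_coef1l rules x_free x0E.
have Nfrob j k s : N j k s = N j s k.
  by rewrite (fusion_coef_dual rules tauE) dualE.
have NC j k s : N j k s = N k j s.
  by rewrite (fusion_coef_rev rules x_free) !dualE.
pose p := N ord3_1 ord3_1 ord3_1; pose q := N ord3_1 ord3_1 ord3_2.
pose s := N ord3_1 ord3_2 ord3_2; pose u := N ord3_2 ord3_2 ord3_2.
have N121 : N ord3_1 ord3_2 ord3_1 = q by rewrite Nfrob.
have N221 : N ord3_2 ord3_2 ord3_1 = s by rewrite Nfrob NC.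
have N110 : N ord3_1 ord3_1 ord0 = 1 by rewrite Nunit dual1.
have N120 : N ord3_1 ord3_2 ord0 = 0 by rewrite Nunit dual2.
have N220 : N ord3_2 ord3_2 ord0 = 1 by rewrite Nunit dual2.
(* The coefficient of x_3 in (x_2 x_2) x_3 = x_2 (x_2 x_3). *)
have assoc : 1 + p * s + q * u = q ^+ 2 + s ^+ 2.
  have := fusion_coef_assoc rules x_free ord3_1 ord3_1 ord3_2 ord3_2.
  rewrite !big_ord3 N110 N120 N121 N1l eqxx mulr1 mul0r add0r.
  by rewrite -/p -/q -/s -/u => ->.
have [e2 [e3 [e2_gt0 e3_gt0 e22 e23 e33]]] :=
  rank3_character (N0 _ _ _ : 0 <= q) (N0 _ _ _ : 0 <= s) assoc.
pose e (j : 'I_3) := [:: 1; e2; e3]`_j.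
have e_norm (j : 'I_3) : left_mul_norm (tau F) x`_j = e j.
  apply: (left_mul_norm_character rules tauE x_basis) => //.
  - by apply: ord3_ind; rewrite /e /=.
  - by move=> k; rewrite dualE.
  move=> i k; rewrite big_ord3; move: i k.
  apply: ord3_ind; apply: ord3_ind; rewrite /e /=
    ?N1l ?(NC _ ord0) ?N1l ?(NC ord3_2 ord3_1) ?N110 ?N120 ?N220 ?N121 ?N221
    -/p -/q -/s -/u /=; lra.
move: dim_x1 dim_x2; rewrite (dimB_basis canon ord3_1) (dimB_basis canon ord3_2).
rewrite !e_norm /e /= => /complexI <- /complexI <- {d2 d3}.
have e2_ge0 := ltW e2_gt0; have e3_ge0 := ltW e3_gt0.
have q0 : 0 <= q := N0 _ _ _.
have s0 : 0 <= s := N0 _ _ _.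
have p0 : 0 <= p := N0 _ _ _.
have u0 : 0 <= u := N0 _ _ _.
have e3N : e3 != 0 by rewrite gt_eqF.
have e2N : e2 != 0 by rewrite gt_eqF.
have bE : 1 - q / e3 = s / e2.
  apply: (mulIf (mulf_neq0 e2N e3N)); rewrite mulrBl mul1r {1}e23; field.
  by rewrite e2N e3N.
(* With [a = q / e3] and [1 - a = s / e2], the last two parameter inequalities amount to
   nonnegativity of [p * e2] and [u * e3]. *)
have pE : e2 ^+ 2 - 1 - q / e3 * e3 ^+ 2 = p * e2.
  by rewrite expr2 e22; field.
have uE : e3 ^+ 2 - 1 - s / e2 * e2 ^+ 2 = u * e3.
  by rewrite expr2 e33; field.
exists (q / e3); split; first split.
- rewrite /rank3_parameters bE pE uE; split.
  (* Compare squares: [e2 * e2] is 1 plus nonnegative terms. *)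
  + rewrite -(@ler_pXn2r _ 2) ?nnegrE ?ler01 // expr1n expr2 e22.
    by have := mulr_ge0 p0 e2_ge0; have := mulr_ge0 q0 e3_ge0; lra.
  + rewrite -(@ler_pXn2r _ 2) ?nnegrE ?ler01 // expr1n expr2 e33.
    by have := mulr_ge0 s0 e2_ge0; have := mulr_ge0 u0 e3_ge0; lra.
  + by rewrite divr_ge0 //= -subr_ge0 bE divr_ge0.
  + by rewrite mulr_ge0.
  by rewrite mulr_ge0.
- rewrite /rank3_multiplication bE pE uE !mulfK // !divfK //; split.
  + by rewrite (xM ord3_1 ord3_1) big_ord3 N110 scale1r.
  + by rewrite (xM ord3_1 ord3_2) big_ord3 N120 N121 scale0r add0r.
  by rewrite (xM ord3_2 ord3_2) big_ord3 N220 N221 scale1r.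
(* Uniqueness: the coefficient of x_3 in x_2 x_2 forces [q = a * e3]. *)
move=> a [_ [x11 _ _]].
pose c (k : 'I_3) : R[i] :=
  [:: 1; ((e2 ^+ 2 - 1 - a * e3 ^+ 2) / e2)%:C; (a * e3)%:C]`_k.
have /free_sum_inj : \sum_k (N ord3_1 ord3_1 k)%:C *: x`_k = \sum_k c k *: x`_k.
  by rewrite -xM [RHS]big_ord3 /c /= scale1r.
move=> /(_ x_free ord3_2) /complexI; rewrite -/q => ->.
by rewrite mulfK.
Qed.

(** * Star algebras on row vectors *)

(** Common interface for building both A and B in the converse. Both are commutative with
    self-adjoint basis vectors, so coordinatewise conjugation serves as the involution. *)
Record starStructure (R : realType) (n : nat) := StarStructure {
  smul : 'rV[R[i]]_n.+1 -> 'rV[R[i]]_n.+1 -> 'rV[R[i]]_n.+1;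
  sone : 'rV[R[i]]_n.+1;
  smulA : associative smul;
  smulC : commutative smul;
  smul1 : left_id sone smul;
  smulDl : left_distributive smul +%R;
  smulZl : forall a u v, a *: smul u v = smul (a *: u) v;
  smul_conj : forall u v,
    map_mx conjc (smul u v) = smul (map_mx conjc u) (map_mx conjc v)
}.

(** The argument [S] only tags the type, so that different products on the same rows get different
    algebra instances. *)
Definition row_alg (R : realType) (n : nat) (S : starStructure R n) : Type :=
  'rV[R[i]]_n.+1.

Section RowAlgebra.
Context (R : realType) (n : nat) (S : starStructure R n).

HB.instance Definition _ := Vector.copy (row_alg S) 'rV[R[i]]_n.+1.

Lemma sone_neq0 : sone S != 0.
Proof.
apply/eqP => one0; have := smul1 S (const_mx 1).
have := smulZl S 0 0 (const_mx 1); rewrite one0 scaler0 scale0r => <-.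
by move/rowP/(_ 0); rewrite !mxE => /eqP; rewrite eq_sym oner_eq0.
Qed.

HB.instance Definition _ := GRing.Zmodule_isComNzRing.Build (row_alg S)
  (smulA S) (smulC S) (smul1 S) (smulDl S) sone_neq0.
HB.instance Definition _ :=
  GRing.Lmodule_isLalgebra.Build R[i] (row_alg S) (smulZl S).
HB.instance Definition _ := GRing.Lalgebra_isComAlgebra.Build R[i] (row_alg S).
HB.instance Definition _ := Algebra_isFalgebra.Build R[i] (row_alg S).

Definition row_star (u : row_alg S) : row_alg S := map_mx conjc u.

Lemma row_star_axioms :
  [/\ forall u v, row_star (u + v) = row_star u + row_star v,
      forall (c : R[i]) u, row_star (c *: u) = conjc c *: row_star u,
      forall u v, row_star (u * v) = row_star v * row_star u
    & involutive row_star].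
Proof.
split=> [u v|c u|u v|u]; last 1 first.
- by apply/rowP=> k; rewrite !mxE conjcK.
- by apply/rowP=> k; rewrite !mxE rmorphD.
- by apply/rowP=> k; rewrite !mxE rmorphM.
by rewrite mulrC; apply: smul_conj.
Qed.

Definition row_starAlgebra := StarAlgebra row_star_axioms.

End RowAlgebra.

(** * The algebra B from its structure constants *)

Section StructureConstants.
Context (R : realType) (n : nat) (N : 'I_n.+1 -> 'I_n.+1 -> 'I_n.+1 -> R).
Context (NC : forall j k s, N j k s = N k j s).
Context (N1 : forall k s, N ord0 k s = (k == s)%:R).
Context (NA : forall j k m s,
  \sum_l N j k l * N l m s = \sum_l N k m l * N j l s).

Definition const_mul (u v : 'rV[R[i]]_n.+1) : 'rV[R[i]]_n.+1 :=
  \sum_j \sum_k (u 0 j * v 0 k) *: \row_s (N j k s)%:C.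

Lemma const_mulC : commutative const_mul.
Proof.
move=> u v; rewrite /const_mul exchange_big; apply: eq_bigr => j _ /=.
apply: eq_bigr => k _; rewrite mulrC; congr (_ *: _).
by apply/rowP=> s; rewrite !mxE NC.
Qed.

Lemma const_mulDl : left_distributive const_mul +%R.
Proof.
move=> u v w; rewrite /const_mul -big_split; apply: eq_bigr => j _ /=.
rewrite -big_split; apply: eq_bigr => k _ /=.
by rewrite mxE mulrDl scalerDl.
Qed.

Lemma const_mulZl a u v : a *: const_mul u v = const_mul (a *: u) v.
Proof.
rewrite /const_mul scaler_sumr; apply: eq_bigr => j _.
rewrite scaler_sumr; apply: eq_bigr => k _.
by rewrite scalerA mxE mulrA.
Qed.

Lemma const_mul_delta j k :
  const_mul (delta_mx 0 j) (delta_mx 0 k) = \row_s (N j k s)%:C.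
Proof.
rewrite /const_mul (bigD1 j) //= [X in _ + X]big1 ?addr0 => [|i /negPf ij].
  rewrite (bigD1 k) //= [X in _ + X]big1 ?addr0 => [|i /negPf ik].
    by rewrite !mxE !eqxx mulr1 scale1r.
  by rewrite !mxE ik andbF mulr0 scale0r.
by rewrite big1 // => l _; rewrite !mxE ij andbF mul0r scale0r.
Qed.

Lemma const_mul_suml (I : finType) (c : I -> R[i]) (u : I -> 'rV_n.+1) v :
  const_mul (\sum_i c i *: u i) v = \sum_i c i *: const_mul (u i) v.
Proof.
rewrite (big_morph (const_mul ^~ v) (id1 := 0) (op1 := +%R)) => [|? ?|].
- by apply: eq_bigr => i _; rewrite const_mulZl.
- exact: const_mulDl.
by have := const_mulZl 0 0 v; rewrite !scale0r => <-.
Qed.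

Lemma const_mul_sumr (I : finType) (c : I -> R[i]) (u : I -> 'rV_n.+1) v :
  const_mul v (\sum_i c i *: u i) = \sum_i c i *: const_mul v (u i).
Proof.
by rewrite const_mulC const_mul_suml; under eq_bigr do rewrite const_mulC.
Qed.

Lemma const_mul1 : left_id (delta_mx 0 ord0) const_mul.
Proof.
move=> u; rewrite [in LHS](row_sum_delta u) const_mul_sumr [RHS]row_sum_delta.
apply: eq_bigr => k _; rewrite const_mul_delta; congr (_ *: _).
by apply/rowP=> s; rewrite !mxE eqxx N1 eq_sym; case: eqP.
Qed.

(** By linearity in each argument it is enough to treat basis vectors, where the claim is [NA]. *)
Lemma const_mulA : associative const_mul.
Proof.
move=> u v w; rewrite (row_sum_delta u) !const_mul_suml.
apply: eq_bigr => j _; congr (_ *: _).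
rewrite (row_sum_delta v) const_mul_suml !const_mul_sumr const_mul_suml.
apply: eq_bigr => k _; congr (_ *: _).
rewrite (row_sum_delta w) !const_mul_sumr.
apply: eq_bigr => m _; congr (_ *: _).
rewrite !const_mul_delta.
rewrite [\row_s (N k m s)%:C]row_sum_delta [\row_s (N j k s)%:C]row_sum_delta.
rewrite const_mul_suml const_mul_sumr; apply/rowP=> s.
rewrite !summxE.
under eq_bigr do rewrite const_mul_delta !mxE -rmorphM.
under [RHS]eq_bigr do rewrite const_mul_delta !mxE -rmorphM.
by rewrite -!rmorph_sum -NA.
Qed.

Lemma const_mul_conj u v :
  map_mx conjc (const_mul u v) = const_mul (map_mx conjc u) (map_mx conjc v).
Proof.
apply/rowP=> s; rewrite /const_mul mxE !summxE rmorph_sum.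
apply: eq_bigr => j _; rewrite !summxE rmorph_sum.
by apply: eq_bigr => k _; rewrite !mxE !rmorphM /= oppr0.
Qed.

Definition const_structure : starStructure R n :=
  StarStructure const_mulA const_mulC const_mul1 const_mulDl const_mulZl
    const_mul_conj.

End StructureConstants.

(* The algebra A in the coordinates of its basis x_1, ..., x_m, so that the
   Fourier transform is the identity on rows. *)
Section DiamondStructure.
Context (R : realType) (n : nat) (d : 'I_n.+1 -> R) (d0 : forall j, 0 < d j).

Definition diamond (u v : 'rV[R[i]]_n.+1) : 'rV[R[i]]_n.+1 :=
  \row_j (((d j)^-1)%:C * (u 0 j * v 0 j)).

Lemma diamondA : associative diamond.
Proof. by move=> u v w; apply/rowP=> j; rewrite !mxE; ring. Qed.

Lemma diamondC : commutative diamond.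
Proof. by move=> u v; apply/rowP=> j; rewrite !mxE; ring. Qed.

(** The vectors [d j] times x_j are orthogonal idempotents of the diamond product; the unit is their
    sum. *)
Lemma diamond1 : left_id (\row_j (d j)%:C) diamond.
Proof.
move=> u; apply/rowP=> j; rewrite !mxE mulrA -rmorphM mulVf ?mul1r //.
by rewrite gt_eqF.
Qed.

Lemma diamondDl : left_distributive diamond +%R.
Proof. by move=> u v w; apply/rowP=> j; rewrite !mxE; ring. Qed.

Lemma diamondZl a u v : a *: diamond u v = diamond (a *: u) v.
Proof. by apply/rowP=> j; rewrite !mxE; ring. Qed.

Lemma diamond_conj u v :
  map_mx conjc (diamond u v) = diamond (map_mx conjc u) (map_mx conjc v).
Proof. by apply/rowP=> j; rewrite !mxE !rmorphM /= oppr0. Qed.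

Definition diamond_structure : starStructure R n :=
  StarStructure diamondA diamondC diamond1 diamondDl diamondZl
    diamond_conj.

End DiamondStructure.

(** * Assembling the canonical fusion bialgebra on rows *)

Section RowBasis.
Context (R : realType) (n : nat).

Definition row_basis (S : starStructure R n) : n.+1.-tuple (row_starAlgebra S) :=
  [tuple (delta_mx 0 j : row_alg S) | j < n.+1].

Lemma row_basisE S (j : 'I_n.+1) : (row_basis S)`_j = delta_mx 0 j.
Proof. by rewrite -tnth_nth tnth_mktuple. Qed.

Lemma row_basisP S : basis_of fullv (row_basis S).
Proof.
rewrite basisEfree subvf dimvf size_tuple dim_matrix mul1r leqnn !andbT.
apply/freeP => k k0 j.
have /rowP/(_ j) := row_sum_delta (\row_i k i); rewrite mxE => ->.
have -> : \sum_i (\row_i k i) 0 i *: delta_mx 0 i = 0 :> 'rV[R[i]]_n.+1.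
  by rewrite -[RHS]k0; apply: eq_bigr => i _; rewrite mxE row_basisE.
by rewrite mxE.
Qed.

Lemma row_basis_star S (j : 'I_n.+1) : star (row_basis S)`_j = (row_basis S)`_j.
Proof.
by rewrite row_basisE; apply/rowP=> k; rewrite !mxE; apply: conjc_nat.
Qed.

(** Serves twice in [row_fusion]: with weights [d] as the functional on A, and with the indicator of
    [ord0] as [tau] on B. *)
Definition row_form (S : starStructure R n) (d : 'I_n.+1 -> R) (v : row_alg S)
  : R[i] := \sum_j (d j)%:C * v 0 j.

Lemma row_form_is_scalar S d : scalar (@row_form S d).
Proof.
move=> a u v; rewrite /row_form mulr_sumr -big_split; apply: eq_bigr => j _ /=.
by rewrite !mxE; ring.
Qed.

HB.instance Definition _ S d := GRing.isLinear.Build R[i] (row_alg S) R[i] _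
  (@row_form S d) (@row_form_is_scalar S d).

Lemma row_form_basis S d (j : 'I_n.+1) : @row_form S d (row_basis S)`_j = (d j)%:C.
Proof.
rewrite row_basisE /row_form (bigD1 j) //= big1 ?addr0 => [|k /negPf kj].
  by rewrite mxE !eqxx mulr1.
by rewrite mxE kj andbF mulr0.
Qed.

Definition row_id (S S' : starStructure R n) (v : row_alg S) : row_alg S' := v.

Lemma row_id_is_linear S S' : linear (@row_id S S').
Proof. by []. Qed.

HB.instance Definition _ S S' := GRing.isLinear.Build R[i] (row_alg S)
  (row_alg S') _ (@row_id S S') (@row_id_is_linear S S').

End RowBasis.

Definition row_fusion (R : realType) (n : nat) (S : starStructure R n)
    (d : 'I_n.+1 -> R) (d0 : forall j, 0 < d j) : fusionData R :=
  @FusionData R (row_starAlgebra (diamond_structure d0)) (row_starAlgebra S)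
    (linfun (@row_id R n (diamond_structure d0) S))
    (@row_form R n (diamond_structure d0) d)
    (@row_form R n S (fun j => (j == ord0)%:R)).

(** The weights [d] put into A have to agree with the operator norms on B; they do because [d] is a
    positive character and the duality is the identity. *)
Lemma row_fusion_canonical (R : realType) (n : nat) (S : starStructure R n)
    (N : 'I_n.+1 -> 'I_n.+1 -> 'I_n.+1 -> R)
    (d : 'I_n.+1 -> R) (d0 : forall j, 0 < d j) :
  (forall j k s, 0 <= N j k s) ->
  (forall j k, N j k ord0 = (j == k)%:R) ->
  (forall j k : 'I_n.+1, (row_basis S)`_j * (row_basis S)`_k
     = \sum_s (N j k s)%:C *: (row_basis S)`_s) ->
  (row_basis S)`_0 = 1 ->
  (forall j k, d j * d k = \sum_s N j k s * d s) ->
  @canonical_fusion_bialgebra R (row_fusion S d0) n (row_basis S)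
  /\ forall j : 'I_n.+1, @dimB R (row_fusion S d0) (row_basis S)`_j = (d j)%:C.
Proof.
move=> N0 Nunit xM x0E d_char.
have rules : fusion_rules (row_basis S) N id.
  by split=> // k; rewrite row_basis_star.
have tauE (j : 'I_n.+1) : tau (row_fusion S d0) (row_basis S)`_j = (j == ord0)%:R.
  by rewrite /= row_form_basis; case: eqP.
have normE :=
  left_mul_norm_character rules tauE (row_basisP S) d0 (fun=> erefl) d_char.
have canon : @canonical_fusion_bialgebra R (row_fusion S d0) n (row_basis S).
  split=> //; first by split=> //; [exact: row_basisP | exists N, id].
  exists (row_basis (diamond_structure d0)); split=> [|j k|j|j|j].
  - exact: row_basisP.
  - rewrite /= row_form_basis !row_basisE.
    apply/rowP=> i; rewrite !mxE !eqxx /=.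
    have [-> /=|ij] := eqVneq i j; last by rewrite mul0r !mulr0.
    rewrite mul1r; have [->|jk] := eqVneq j k; last by rewrite mulr0 mul0r.
    by rewrite mul1r fmorphV.
  - exact: row_basis_star.
  - by rewrite normE /= row_form_basis.
  by rewrite /= lfunE /= !row_basisE.
by split=> // j; rewrite (dimB_basis canon) normE.
Qed.

(** * Rank three: from the parameters to the bialgebra *)

(** Entry j, k lists the coefficients of x_j x_k. A literal table lets identities reduce by
    computation at concrete indices. *)
Definition rank3_coef (R : realType) (p q s u : R) (j k l : 'I_3) : R :=
  (nth [::] (nth [::]
    [:: [:: [:: 1; 0; 0]; [:: 0; 1; 0]; [:: 0; 0; 1]];
        [:: [:: 0; 1; 0]; [:: 1; p; q]; [:: 0; q; s]];
        [:: [:: 0; 0; 1]; [:: 0; q; s]; [:: 1; s; u]]] j) k)`_l.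

Lemma rank3_realization (R : realType) (d2 d3 a : R) :
  rank3_parameters d2 d3 a ->
  exists (F : fusionData R) (x : 3.-tuple (fusB F)),
    [/\ canonical_fusion_bialgebra x,
        forall j : 'I_3, star x`_j = x`_j,
        dimB x`_1 = d2%:C /\ dimB x`_2 = d3%:C,
        rank3_multiplication x`_0 x`_1 x`_2 d2 d3 a
      & x`_2 * x`_1 = x`_1 * x`_2].
Proof.
case=> d2_ge1 d3_ge1 /andP[a_ge0 a_le1] p_ge0 u_ge0.
have d2_gt0 : 0 < d2 by lra.
have d3_gt0 : 0 < d3 by lra.
have d2N : d2 != 0 by rewrite gt_eqF.
have d3N : d3 != 0 by rewrite gt_eqF.
pose p := (d2 ^+ 2 - 1 - a * d3 ^+ 2) / d2; pose q := a * d3.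
pose s := (1 - a) * d2; pose u := (d3 ^+ 2 - 1 - (1 - a) * d2 ^+ 2) / d3.
have p0 : 0 <= p by rewrite divr_ge0 // ltW.
have q0 : 0 <= q by rewrite mulr_ge0 // ltW.
have s0 : 0 <= s by rewrite mulr_ge0 ?subr_ge0 // ltW.
have u0 : 0 <= u by rewrite divr_ge0 // ltW.
have assoc : 1 + p * s + q * u = q ^+ 2 + s ^+ 2.
  by rewrite /p /q /s /u; field; rewrite d2N d3N.
have d22 : d2 * d2 = 1 + p * d2 + q * d3 by rewrite /p /q; field.
have d23 : d2 * d3 = q * d2 + s * d3 by rewrite /q /s; ring.
have d33 : d3 * d3 = 1 + s * d2 + u * d3 by rewrite /s /u; field.
pose d (j : 'I_3) := [:: 1; d2; d3]`_j.
have d0 j : 0 < d j by move: j; apply: ord3_ind.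
pose N := rank3_coef p q s u.
have NC j k l : N j k l = N k j l.
  by move: j k l; do 3! apply: ord3_ind.
have N1 k l : N ord0 k l = (k == l)%:R.
  by move: k l; do 2! apply: ord3_ind.
have NA j k m l : \sum_i N j k i * N i m l = \sum_i N k m i * N j i l.
  (* With [p], [q], [s], [u] made opaque, each of the 81 instances is a linear consequence of
     [assoc], products being treated as atoms. *)
  rewrite !big_ord3; clearbody p q s u.
  by move: j k m l; do 4! apply: ord3_ind; rewrite /N /rank3_coef /=; lra.
have Nunit j k : N j k ord0 = (j == k)%:R.
  by move: j k; do 2! apply: ord3_ind.
pose S := const_structure NC N1 NA.
pose x := row_basis S.
have xM (j k : 'I_3) : x`_j * x`_k = \sum_s (N j k s)%:C *: x`_s.
  rewrite !row_basisE [LHS]const_mul_delta [LHS]row_sum_delta.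
  by apply: eq_bigr => i _; rewrite mxE row_basisE.
have [|||canon dimE] := @row_fusion_canonical R 2 S N d d0 _ Nunit xM.
- by do 3! apply: ord3_ind.
- by rewrite (row_basisE S ord0).
- move=> j k; rewrite big_ord3; clearbody p q s u.
  by move: j k; do 2! apply: ord3_ind; rewrite /N /d /rank3_coef /=; lra.
exists (row_fusion S d0), x; split=> //.
- exact: row_basis_star.
- by split; [exact: (dimE ord3_1) | exact: (dimE ord3_2)].
- rewrite /rank3_multiplication -/p -/q -/s -/u; split.
  + by rewrite (xM ord3_1 ord3_1) big_ord3 scale1r.
  + by rewrite (xM ord3_1 ord3_2) big_ord3 scale0r add0r.
  by rewrite (xM ord3_2 ord3_2) big_ord3 scale1r.
by rewrite mulrC.
Qed.

Theorem proposition2p28 (R : realType) :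
  (forall (F : fusionData R) (x : 3.-tuple (fusB F)) (d2 d3 : R),
     canonical_fusion_bialgebra x ->
     star x`_1 = x`_1 ->
     dimB x`_1 = d2%:C ->
     dimB x`_2 = d3%:C ->
     exists! a : R,
       rank3_parameters d2 d3 a /\
       rank3_multiplication x`_0 x`_1 x`_2 d2 d3 a)
  /\
  (forall d2 d3 a : R,
     rank3_parameters d2 d3 a ->
     exists (F : fusionData R) (x : 3.-tuple (fusB F)),
       [/\ canonical_fusion_bialgebra x,
           forall j : 'I_3, star x`_j = x`_j,
           dimB x`_1 = d2%:C /\ dimB x`_2 = d3%:C,
           rank3_multiplication x`_0 x`_1 x`_2 d2 d3 a
         & x`_2 * x`_1 = x`_1 * x`_2]).
Proof.
split; [exact: rank3_classification | exact: rank3_realization].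
Qed.
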